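(* Let $\underline{B}$ be an additive category. The following assumptions on $\underline{B}$ are equivalent. (1) $\underline{B}$ is weakly idempotent complete. (2) $\underline{B}$ is weakly retraction-closed in any additive category $\underline{B}'$ containing $\underline{B}$ as a strictly full subcategory. (3) $\underline{B}$ is a weakly retraction-closed subcategory of some weakly idempotent complete category $\underline{B}'$. (4) The obvious embedding of $\underline{B}$ into the category $\operatorname{wKar}(\underline{B})=\operatorname{wKar}_{\operatorname{Kar}(\underline{B})}(\underline{B})$ is an equivalence. (5) $\underline{B}$ is equivalent to the category $\operatorname{wKar}(\underline{B}'')$ for some additive category $\underline{B}''$. (6) There exist additive categories $\underline{B}''\subset\underline{B}\subset\underline{B}'$ (full subcategories) such that $\underline{B}'$ is idempotent complete and $\underline{B}=\operatorname{wKar}_{\underline{B}'}(\underline{B}'')$. (7) If a bounded $\underline{B}$-complex is contractible (i.e. it is zero in $K^b(\underline{B})$) then it splits, that is, it has the form $\bigoplus_i \operatorname{id}_{N^i}[-i]$ for some $N^i\in\operatorname{Obj}\underline{B}$.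
   Context: All categories and functors are additive; $\underline{A}'\subset\underline{A}$ means that $\underline{A}'$ is a full subcategory of $\underline{A}$. An additive category $\underline{B}$ is weakly idempotent complete if every split monomorphism $i:X\to Y$ in $\underline{B}$ (i.e. $p\circ i=\operatorname{id}_X$ for some $p\in\underline{B}(Y,X)$) is isomorphic to the monomorphism $\operatorname{id}_X\bigoplus 0:X\to X\bigoplus Z$ for some object $Z$ of $\underline{B}$. It is idempotent complete if any idempotent endomorphism in it gives a direct sum decomposition. For a full additive subcategory $\underline{A}'\subset\underline{A}$, the weak retraction-closure $\operatorname{wKar}_{\underline{A}}(\underline{A}')$ is the full subcategory of $\underline{A}$ whose objects are those $Z\in\operatorname{Obj}\underline{A}$ for which there exist $X,Y\in\operatorname{Obj}\underline{A}'$ with $X\bigoplus Z\cong Y$. The subcategory $\underline{A}'$ is weakly retraction-closed in $\underline{A}$ if $\operatorname{wKar}_{\underline{A}}(\underline{A}')=\underline{A}'$. The idempotent completion $\operatorname{Kar}(\underline{A})$ has as objects the pairs $(B,p)$ with $B\in\operatorname{Obj}\underline{A}$, $p\in\underline{A}(B,B)$, $p^2=p$, and morphisms $\operatorname{Kar}(\underline{A})((X,p),(X',p'))=\{f\in\underline{A}(X,X'):p'\circ f=f\circ p=f\}$; $\underline{A}$ is fully embedded into it by $B\mapsto(B,\operatorname{id}_B)$. For any additive $\underline{A}$, $\operatorname{wKar}(\underline{A})=\operatorname{wKar}_{\operatorname{Kar}(\underline{A})}(\underline{A})$. $K^b(\underline{B})$ is the homotopy category of bounded complexes over $\underline{B}$.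 In (7), $\operatorname{id}_{N}$ is regarded as a two-term complex $N\xrightarrow{\operatorname{id}}N$ placed in two adjacent degrees, $[-i]$ is a shift, and ''has the form'' means isomorphism in the category of complexes (not just up to homotopy). *)

(* Defs.v *)
From HB Require Import structures.
From mathcomp Require Import all_boot all_order all_algebra.
From mathcomp Require Import boolp.

Set Implicit Arguments.
Unset Strict Implicit.
Unset Printing Implicit Defensive.

Import Order.TTheory GRing.Theory Num.Theory.

Local Open Scope ring_scope.

Declare Scope cat_scope.
Delimit Scope cat_scope with cat.
Local Open Scope cat_scope.

Record preAddCat := PreAddCat {
  ob :> Type;
  hom : ob -> ob -> zmodType;
  idm : forall X, hom X X;
  comp : forall X Y Z, hom Y Z -> hom X Y -> hom X Z;
  comp1m : forall X Y (f : hom X Y), comp (idm Y) f = f;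
  compm1 : forall X Y (f : hom X Y), comp f (idm X) = f;
  compmA : forall W X Y Z (h : hom Y Z) (g : hom X Y) (f : hom W X),
    comp h (comp g f) = comp (comp h g) f;
  compDl : forall X Y Z (g g' : hom Y Z) (f : hom X Y),
    comp (g + g') f = comp g f + comp g' f;
  compDr : forall X Y Z (g : hom Y Z) (f f' : hom X Y),
    comp g (f + f') = comp g f + comp g f'
}.

Arguments hom {p} X Y.
Arguments idm {p} X.
Arguments comp {p X Y Z} g f.
Notation "g ∘ f" := (comp g f) (at level 40, left associativity) : cat_scope.

Section PreAdditive.
Variable A : preAddCat.
Implicit Types X Y Z S : A.

Lemma comp0m X Y Z (f : hom X Y) : (0 : hom Y Z) ∘ f = 0.
Proof. by apply: (addIr ((0 : hom Y Z) ∘ f)); rewrite -compDl !add0r. Qed.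

Lemma compm0 X Y Z (g : hom Y Z) : g ∘ (0 : hom X Y) = 0.
Proof. by apply: (addIr (g ∘ (0 : hom X Y))); rewrite -compDr !add0r. Qed.

Lemma compNm X Y Z (g : hom Y Z) (f : hom X Y) : (- g) ∘ f = - (g ∘ f).
Proof. by apply: (addIr (g ∘ f)); rewrite -compDl !addNr comp0m. Qed.

Lemma compmN X Y Z (g : hom Y Z) (f : hom X Y) : g ∘ (- f) = - (g ∘ f).
Proof. by apply: (addIr (g ∘ f)); rewrite -compDr !addNr compm0. Qed.

Definition is_zero X : Prop :=
  forall Y, (forall f : hom X Y, f = 0) /\ (forall f : hom Y X, f = 0).

Record biproduct X Y S := Biproduct {
  in1 : hom X S;
  in2 : hom Y S;
  pr1 : hom S X;
  pr2 : hom S Y;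
  pr1_in1 : pr1 ∘ in1 = idm X;
  pr2_in2 : pr2 ∘ in2 = idm Y;
  pr1_in2 : pr1 ∘ in2 = 0;
  pr2_in1 : pr2 ∘ in1 = 0;
  in_pr : in1 ∘ pr1 + in2 ∘ pr2 = idm S
}.

Record direct_sum (I : finType) (X : I -> A) S := DirectSum {
  inj : forall i, hom (X i) S;
  proj : forall i, hom S (X i);
  proj_inj : forall i, proj i ∘ inj i = idm (X i);
  proj_inj_neq : forall i j, i != j -> proj i ∘ inj j = 0;
  inj_proj : \sum_i inj i ∘ proj i = idm S
}.

Definition is_iso X Y (f : hom X Y) : Prop :=
  exists g : hom Y X, g ∘ f = idm X /\ f ∘ g = idm Y.

Definition isomorphic X Y : Prop := exists f : hom X Y, is_iso f.

Definition split_mono X Y (i : hom X Y) : Prop :=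
  exists p : hom Y X, p ∘ i = idm X.

Definition iso_morphisms X Y X' Y' (f : hom X Y) (f' : hom X' Y') : Prop :=
  exists (a : hom X X') (b : hom Y Y'), [/\ is_iso a, is_iso b & b ∘ f = f' ∘ a].

(* The inclusion [in1 b] of a summand is the morphism id ⊕ 0 : X → X ⊕ Z. *)
Definition weakly_idempotent_complete : Prop :=
  forall X Y (i : hom X Y), split_mono i ->
    exists Z S (b : biproduct X Z S), iso_morphisms i (in1 b).

Definition idempotent_complete : Prop :=
  forall X (p : hom X X), p ∘ p = p ->
    exists Y Z (b : biproduct Y Z X), p = in1 b ∘ pr1 b.

(* Full subcategories are given by their predicate on objects. *)
Definition wKar_in (P : A -> Prop) : A -> Prop := fun Z =>
  exists X Y, [/\ P X, P Y &
    exists S (_ : biproduct X Z S), isomorphic S Y].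

Definition weakly_retraction_closed (P : A -> Prop) : Prop :=
  forall Z, wKar_in P Z <-> P Z.

Definition full_subcat (P : A -> Prop) : preAddCat.
Proof.
refine (@PreAddCat {X : A | P X} (fun U V => hom (sval U) (sval V))
  (fun U => idm (sval U))
  (fun U V W => @comp A (sval U) (sval V) (sval W)) _ _ _ _ _).
- by move=> X Y f; apply: comp1m.
- by move=> X Y f; apply: compm1.
- by move=> W X Y Z h g f; apply: compmA.
- by move=> X Y Z g g' f; apply: compDl.
- by move=> X Y Z g f f'; apply: compDr.
Defined.

End PreAdditive.

Record addCat := AddCat {
  addcat :> preAddCat;
  has_zero : exists X : addcat, is_zero X;
  has_biproduct : forall X Y : addcat, exists S, inhabited (biproduct X Y S)
}.

Definition zero_ob (A : addCat) : A := sval (cid (has_zero A)).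

Lemma zero_obP (A : addCat) : is_zero (zero_ob A).
Proof. exact: svalP (cid (has_zero A)). Qed.

Record functor (A B : preAddCat) := Functor {
  fob :> A -> B;
  fmor : forall X Y, {additive hom X Y -> hom (fob X) (fob Y)};
  fmor1 : forall X, fmor X X (idm X) = idm (fob X);
  fmorM : forall X Y Z (g : hom Y Z) (f : hom X Y),
    fmor X Z (g ∘ f) = fmor Y Z g ∘ fmor X Y f
}.

Arguments fmor {A B} _ {X Y}.

Definition functor_id (A : preAddCat) : functor A A :=
  @Functor A A id (fun X Y => idfun) (fun X => erefl) (fun X Y Z g f => erefl).

Section FunctorComp.
Variables (A B C : preAddCat) (G : functor B C) (F : functor A B).

Let cmor (X Y : A) : {additive hom X Y -> hom (G (F X)) (G (F Y))} :=
  fmor G \o fmor F.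

Fact cmor1 (X : A) : cmor X X (idm X) = idm (G (F X)).
Proof. by rewrite /= !fmor1. Qed.

Fact cmorM (X Y Z : A) (g : hom Y Z) (f : hom X Y) :
  cmor X Z (g ∘ f) = cmor Y Z g ∘ cmor X Y f.
Proof. by rewrite /= !fmorM. Qed.

Definition functor_comp : functor A C := Functor cmor1 cmorM.

End FunctorComp.

Section Functors.
Variables A B : preAddCat.
Implicit Types F G : functor A B.

Definition nat_iso F G : Prop :=
  exists eta : forall X, hom (F X) (G X),
    (forall X, is_iso (eta X)) /\
    (forall X Y (f : hom X Y), eta Y ∘ fmor F f = fmor G f ∘ eta X).

Definition full F : Prop :=
  forall (X Y : A) (g : hom (F X) (F Y)), exists f : hom X Y, fmor F f = g.

Definition faithful F : Prop := forall X Y : A, injective (@fmor A B F X Y).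

(* [full_embedding F] exhibits A as a full subcategory of B. *)
Definition full_embedding F : Prop := [/\ injective F, full F & faithful F].

Definition ob_image F : B -> Prop := fun Z => exists X, F X = Z.

Definition strictly_full_embedding F : Prop :=
  full_embedding F /\
  forall Y Z : B, isomorphic Y Z -> ob_image F Y -> ob_image F Z.

End Functors.

Definition is_equivalence (A B : preAddCat) (F : functor A B) : Prop :=
  exists G : functor B A,
    nat_iso (functor_comp G F) (functor_id A) /\
    nat_iso (functor_comp F G) (functor_id B).

Definition equivalent (A B : preAddCat) : Prop :=
  exists F : functor A B, is_equivalence F.

Section Kar.
Variable A : preAddCat.

Record kar_ob := KarOb {
  kob : A;
  kidem : hom kob kob;
  kidemP : kidem ∘ kidem = kidem
}.

Definition kar_pred (P Q : kar_ob) : pred (hom (kob P) (kob Q)) :=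
  fun f => (kidem Q ∘ f == f) && (f ∘ kidem P == f).
Arguments kar_pred : clear implicits.

Fact kar_pred_zmod P Q : zmod_closed (kar_pred P Q).
Proof.
split; first by rewrite unfold_in compm0 comp0m eqxx.
move=> f g /andP[/eqP f1 /eqP f2] /andP[/eqP g1 /eqP g2].
by rewrite unfold_in compDr compDl compmN compNm f1 f2 g1 g2 !eqxx.
Qed.

HB.instance Definition _ P Q :=
  GRing.isZmodClosed.Build (hom (kob P) (kob Q)) (kar_pred P Q)
    (kar_pred_zmod P Q).

Record kar_hom P Q := KarHom {
  kval :> hom (kob P) (kob Q);
  kvalP : kar_pred P Q kval
}.

HB.instance Definition _ P Q := [isSub for @kval P Q].
HB.instance Definition _ P Q := [Choice of kar_hom P Q by <:].
HB.instance Definition _ P Q := [SubChoice_isSubZmodule of kar_hom P Q by <:].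

Lemma kar_homP P Q (f g : kar_hom P Q) : kval f = kval g -> f = g.
Proof. exact: val_inj. Qed.

Fact kar_id_subproof P : kar_pred P P (kidem P).
Proof. by rewrite /kar_pred kidemP eqxx. Qed.

Definition kar_id P : kar_hom P P := KarHom (kar_id_subproof P).

Fact kar_comp_subproof P Q R (g : kar_hom Q R) (f : kar_hom P Q) :
  kar_pred P R (kval g ∘ kval f).
Proof.
have /andP[/eqP g1 _] := kvalP g; have /andP[_ /eqP f2] := kvalP f.
by rewrite /kar_pred compmA g1 -compmA f2 !eqxx.
Qed.

Definition kar_comp P Q R (g : kar_hom Q R) (f : kar_hom P Q) : kar_hom P R :=
  KarHom (kar_comp_subproof g f).

Definition Kar : preAddCat.
Proof.
refine (@PreAddCat kar_ob kar_hom kar_id kar_comp _ _ _ _ _).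
- by move=> P Q f; apply: kar_homP; have /andP[/eqP] := kvalP f.
- by move=> P Q f; apply: kar_homP; have /andP[_ /eqP] := kvalP f.
- by move=> P Q R S h g f; apply: kar_homP; rewrite /= compmA.
- by move=> P Q R g g' f; apply: kar_homP; rewrite /= compDl.
- by move=> P Q R g f f'; apply: kar_homP; rewrite /= compDr.
Defined.

Definition kar_emb_ob (X : A) : Kar := KarOb (comp1m (idm X)).

Fact kar_emb_subproof (X Y : A) (f : hom X Y) :
  kar_pred (kar_emb_ob X) (kar_emb_ob Y) f.
Proof. by rewrite /kar_pred /= comp1m compm1 eqxx. Qed.

Definition kar_emb_mor (X Y : A) (f : hom X Y) :
  @hom Kar (kar_emb_ob X) (kar_emb_ob Y) := KarHom (kar_emb_subproof f).

Fact kar_emb_zmod X Y : zmod_morphism (@kar_emb_mor X Y).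
Proof. by move=> f g; apply: kar_homP. Qed.

HB.instance Definition _ X Y :=
  GRing.isZmodMorphism.Build (hom X Y)
    (@hom Kar (kar_emb_ob X) (kar_emb_ob Y)) (@kar_emb_mor X Y)
    (@kar_emb_zmod X Y).

Definition kar_emb : functor A Kar.
Proof.
refine (@Functor A Kar kar_emb_ob (fun X Y => @kar_emb_mor X Y) _ _).
- by move=> X; apply: kar_homP.
- by move=> X Y Z g f; apply: kar_homP.
Defined.

End Kar.

Section WKar.
Variable A : addCat.

Definition wKar : preAddCat := full_subcat (wKar_in (ob_image (kar_emb A))).

Fact wkar_emb_subproof (X : A) : wKar_in (ob_image (kar_emb A)) (kar_emb A X).
Proof.
exists (kar_emb A (zero_ob A)), (kar_emb A X).
split; [by exists (zero_ob A) | by exists X | exists (kar_emb A X)].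
have z0 : idm (kar_emb A (zero_ob A)) = 0.
  by apply: kar_homP; apply: (zero_obP (zero_ob A)).1.
have b : biproduct (kar_emb A (zero_ob A)) (kar_emb A X) (kar_emb A X).
  apply: (@Biproduct _ _ _ _ 0 (idm (kar_emb A X)) 0 (idm (kar_emb A X))).
  - by rewrite comp0m z0.
  - by rewrite comp1m.
  - by rewrite comp0m.
  - by rewrite compm0.
  - by rewrite comp0m comp1m add0r.
exists b, (idm (kar_emb A X)), (idm (kar_emb A X)).
by split; rewrite comp1m.
Qed.

Definition wkar_emb : functor A wKar.
Proof.
refine (@Functor A wKar
  (fun X => exist _ (kar_emb A X) (wkar_emb_subproof X))
  (fun X Y => fmor (kar_emb A)) _ _).
- by move=> X; apply: (fmor1 (kar_emb A)).
- by move=> X Y Z g f; apply: (fmorM (kar_emb A)).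
Defined.

End WKar.

Section Complexes.
Variable A : preAddCat.

Record complex := Complex {
  term :> int -> A;
  diff : forall i, hom (term i) (term (i + 1));
  diff2 : forall i, diff (i + 1) ∘ diff i = 0;
  bounded : exists n : int, forall i, n < `|i| -> is_zero (term i)
}.

Record chain_map (C D : complex) := ChainMap {
  cmap :> forall i, hom (C i) (D i);
  cmapP : forall i, cmap (i + 1) ∘ diff C i = diff D i ∘ cmap i
}.

Lemma chain_mapP (C D : complex) (f g : chain_map C D) :
  (forall i, f i = g i) -> f = g.
Proof.
case: f g => [f fP] [g gP] /= fg.
have {}fg : f = g by apply: functional_extensionality_dep.
by subst g; congr ChainMap; apply: Prop_irrelevance.
Qed.

HB.instance Definition _ (C D : complex) := gen_eqMixin (chain_map C D).
HB.instance Definition _ (C D : complex) := gen_choiceMixin (chain_map C D).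

Section ChainMapZmod.
Variables C D : complex.
Implicit Types f g : chain_map C D.

Fact chain_zero_subproof i :
  (0 : hom (C (i + 1)) (D (i + 1))) ∘ diff C i = diff D i ∘ 0.
Proof. by rewrite comp0m compm0. Qed.

Definition chain_zero : chain_map C D := ChainMap chain_zero_subproof.

Fact chain_opp_subproof f i :
  (- f (i + 1)) ∘ diff C i = diff D i ∘ (- f i).
Proof. by rewrite compNm compmN cmapP. Qed.

Definition chain_opp f : chain_map C D := ChainMap (chain_opp_subproof f).

Fact chain_add_subproof f g i :
  (f (i + 1) + g (i + 1)) ∘ diff C i = diff D i ∘ (f i + g i).
Proof. by rewrite compDl compDr !cmapP. Qed.

Definition chain_add f g : chain_map C D := ChainMap (chain_add_subproof f g).

Fact chain_addA : associative chain_add.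
Proof. by move=> f g h; apply: chain_mapP => i; apply: addrA. Qed.

Fact chain_addC : commutative chain_add.
Proof. by move=> f g; apply: chain_mapP => i; apply: addrC. Qed.

Fact chain_add0 : left_id chain_zero chain_add.
Proof. by move=> f; apply: chain_mapP => i; apply: add0r. Qed.

Fact chain_addN : left_inverse chain_zero chain_opp chain_add.
Proof. by move=> f; apply: chain_mapP => i; apply: addNr. Qed.

HB.instance Definition _ := GRing.isZmodule.Build (chain_map C D)
  chain_addA chain_addC chain_add0 chain_addN.

End ChainMapZmod.

Fact chain_id_subproof (C : complex) i :
  idm (C (i + 1)) ∘ diff C i = diff C i ∘ idm (C i).
Proof. by rewrite comp1m compm1. Qed.

Definition chain_id (C : complex) : chain_map C C :=
  ChainMap (@chain_id_subproof C).

Fact chain_comp_subproof (C D E : complex)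
    (g : chain_map D E) (f : chain_map C D) i :
  (g (i + 1) ∘ f (i + 1)) ∘ diff C i = diff E i ∘ (g i ∘ f i).
Proof. by rewrite compmA -cmapP -!compmA cmapP. Qed.

Definition chain_comp (C D E : complex)
    (g : chain_map D E) (f : chain_map C D) : chain_map C E :=
  ChainMap (chain_comp_subproof g f).

Definition Cb : preAddCat.
Proof.
refine (@PreAddCat complex chain_map chain_id chain_comp _ _ _ _ _).
- by move=> C D f; apply: chain_mapP => i; apply: comp1m.
- by move=> C D f; apply: chain_mapP => i; apply: compm1.
- by move=> C D E F h g f; apply: chain_mapP => i; apply: compmA.
- by move=> C D E g g' f; apply: chain_mapP => i; apply: compDl.
- by move=> C D E g f f'; apply: chain_mapP => i; apply: compDr.
Defined.

(* The condition f^j = d h^j + h^(j+1) d is stated at j = i + 1, with [h i]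
   standing for h^(i+1); as i ranges over all integers, so does j. *)
Definition null_homotopic (C D : complex) (f : chain_map C D) : Prop :=
  exists h : forall i, hom (C (i + 1)) (D i),
    forall i, f (i + 1) = diff D i ∘ h i + h (i + 1) ∘ diff C (i + 1).

Definition null_pred (C D : complex) : pred (chain_map C D) :=
  fun f => `[< null_homotopic f >].
Arguments null_pred : clear implicits.

Fact null_pred_zmod (C D : complex) : zmod_closed (null_pred C D).
Proof.
split.
  apply/asboolP; exists (fun i => 0) => i.
  by rewrite comp0m compm0 addr0.
move=> f g /asboolP[h hP] /asboolP[k kP].
apply/asboolP; exists (fun i => h i - k i) => i.
rewrite compDl compDr compmN compNm addrACA -opprD -hP -kP.
by [].
Qed.

HB.instance Definition _ (C D : complex) :=
  GRing.isZmodClosed.Build (chain_map C D) (null_pred C D) (null_pred_zmod C D).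

Definition Kb_hom (C D : complex) : zmodType :=
  Quotient.quot (GRing.ZmodClosed.clone _ (null_pred C D) _).

Definition Kb_class (C D : complex) (f : chain_map C D) : Kb_hom C D :=
  (\pi f)%qT.

Definition Kb_repr (C D : complex) (f : Kb_hom C D) : chain_map C D := repr f.

Lemma Kb_reprK (C D : complex) : cancel (@Kb_repr C D) (@Kb_class C D).
Proof. exact: reprK. Qed.

Lemma Kb_classP (C D : complex) (f g : chain_map C D) :
  Kb_class f = Kb_class g <-> null_homotopic (f - g).
Proof.
split=> [/eqP | fg].
  by rewrite -Quotient.idealrBE => /asboolP.
by apply/eqP; rewrite -Quotient.idealrBE; apply/asboolP.
Qed.

Lemma Kb_classD (C D : complex) : {morph @Kb_class C D : f g / f + g}.
Proof. by move=> f g; rewrite /Kb_class piE. Qed.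

Lemma null_homotopic_comp (C C' D D' : complex)
    (g : chain_map D D') (f : chain_map C D) (e : chain_map C' C) :
  null_homotopic f -> null_homotopic (chain_comp g (chain_comp f e)).
Proof.
case=> h hP; exists (fun i => g i ∘ (h i ∘ e (i + 1))) => i /=.
rewrite hP compDl compDr !compmA -cmapP; congr (_ + _).
by rewrite -!compmA cmapP.
Qed.

Definition Kb_comp (C D E : complex) (g : Kb_hom D E) (f : Kb_hom C D) :
  Kb_hom C E := Kb_class (chain_comp (Kb_repr g) (Kb_repr f)).

Lemma Kb_compE (C D E : complex) (g : chain_map D E) (f : chain_map C D) :
  Kb_comp (Kb_class g) (Kb_class f) = Kb_class (chain_comp g f).
Proof.
have [hf hg] : null_homotopic (f - Kb_repr (Kb_class f)) /\
    null_homotopic (g - Kb_repr (Kb_class g)).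
  by split; apply/Kb_classP; rewrite Kb_reprK.
apply/esym; apply: (@etrans _ _ (Kb_class (chain_comp g (Kb_repr (Kb_class f))))).
  apply/Kb_classP.
  set f' := Kb_repr _ in hf *.
  suff -> : chain_comp g f - chain_comp g f' =
      chain_comp g (chain_comp (f - f') (chain_id C)).
    exact: null_homotopic_comp.
  by apply: chain_mapP => i /=; rewrite compm1 compDr compmN.
apply/Kb_classP.
set f' := Kb_repr (Kb_class f); set g' := Kb_repr _ in hg *.
suff -> : chain_comp g f' - chain_comp g' f' =
    chain_comp (chain_id E) (chain_comp (g - g') f').
  exact: null_homotopic_comp.
by apply: chain_mapP => i /=; rewrite comp1m compDl compNm.
Qed.

Definition Kb : preAddCat.
Proof.
refine (@PreAddCat complex Kb_hom (fun C => Kb_class (chain_id C)) Kb_comp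
  _ _ _ _ _).
- move=> C D f; rewrite -(Kb_reprK f) Kb_compE.
  by congr Kb_class; apply: (@comp1m Cb).
- move=> C D f; rewrite -(Kb_reprK f) Kb_compE.
  by congr Kb_class; apply: (@compm1 Cb).
- move=> C D E F h g f; rewrite -(Kb_reprK h) -(Kb_reprK g) -(Kb_reprK f).
  by rewrite !Kb_compE; congr Kb_class; apply: (@compmA Cb).
- move=> C D E g g' f; rewrite -(Kb_reprK g) -(Kb_reprK g') -(Kb_reprK f).
  rewrite -Kb_classD !Kb_compE -Kb_classD.
  by congr Kb_class; apply: (@compDl Cb).
- move=> C D E g f f'; rewrite -(Kb_reprK g) -(Kb_reprK f) -(Kb_reprK f').
  rewrite -Kb_classD !Kb_compE -Kb_classD.
  by congr Kb_class; apply: (@compDr Cb).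
Defined.

Definition contractible (C : complex) : Prop := is_zero (C : Kb).

End Complexes.

Section TwoTerm.
Variables (A : addCat) (N : A) (i : int).

Definition two_term_ob (j : int) : A :=
  if (j == i) || (j == i + 1) then N else zero_ob A.

Definition two_term_in (j : int) : hom N (two_term_ob j) :=
  if (j == i) || (j == i + 1) as b return hom N (if b then N else zero_ob A)
  then idm N else 0.

Definition two_term_out (j : int) : hom (two_term_ob j) N :=
  if (j == i) || (j == i + 1) as b return hom (if b then N else zero_ob A) N
  then idm N else 0.

(* At j = i both [two_term_out] and [two_term_in] are id_N, hence so is the
   differential. *)
Definition two_term_diff (j : int) :
    hom (two_term_ob j) (two_term_ob (j + 1)) :=
  if j == i then two_term_in (j + 1) ∘ two_term_out j else 0.

Fact two_term_diff2 j : two_term_diff (j + 1) ∘ two_term_diff j = 0.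
Proof.
rewrite /two_term_diff; have [->|_] := eqVneq j i; last by rewrite compm0.
have -> : (i + 1 == i) = false by apply/negP; rewrite -subr_eq0 addrC addKr.
by rewrite comp0m.
Qed.

Fact two_term_bounded :
  exists n : int, forall j, n < `|j| -> is_zero (two_term_ob j).
Proof.
exists (`|i| + 1) => j nj.
rewrite /two_term_ob; case: ifP => [/orP[]/eqP ji | _]; last exact: zero_obP.
  by move: nj; rewrite ji ltNge ler_wpDr.
by move: nj; rewrite ji ltNge (le_trans (ler_normD _ _)) // normr1.
Qed.

(* id_N[-i] : the complex N → N with terms in degrees i and i + 1. *)
Definition two_term : complex A := Complex two_term_diff2 two_term_bounded.

End TwoTerm.

(* C ≅ ⊕_i id_(N^i)[-i] in the category of complexes, where i ranges over
   the finite interval a <= i < a + n. *)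
Definition splits (A : addCat) (C : complex A) : Prop :=
  exists (a : int) (n : nat) (N : int -> A) (S : Cb A)
    (_ : direct_sum (fun k : 'I_n => two_term (N (a + k%:Z)) (a + k%:Z) : Cb A) S),
    @isomorphic (Cb A) C S.

(* Main.v *)
From HB Require Import structures.
From mathcomp Require Import all_boot all_order all_algebra.
From mathcomp Require Import boolp zify.
Require Import Defs.

(** All conditions are compared with (1), in the following form: for every
    retraction [p] of a morphism [i : X -> Y] the object [Y] is a biproduct of
    [X] and some [Z], with injection [i] and projection [p].

    Complements are the link with retraction-closure.  For a fully faithful
    functor [F : A -> K], an object [Z] of [wKar_in (ob_image F)] is a
    complement in [K] of the image of a split monomorphism of [A].  If [A]
    is weakly idempotent complete, this monomorphism has a complement in [A]
    already, and uniqueness of complements identifies its image with [Z]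
    ([wKar_in_weakly_idempotent_complete]).  If [K] is weakly idempotent
    complete and the image of [F] is closed under [wKar_in], complements may
    be taken in [K] and descend to [A]
    ([weakly_idempotent_complete_wKar_in]).  With the idempotence of the
    operation [wKar_in] ([wKar_in_idem]), this settles (1)--(6) as soon as a
    suitable ambient category is known.  The ambient category is [Kar B],
    which is idempotent complete; since (2), (3) and (6) speak of equality of
    classes of objects rather than of isomorphism, it is replaced by an
    equivalent category in which [B] is closed under isomorphism
    ([strict_Kar]).

    For (7), let [h] be a contracting homotopy of [C].  In degree [i + 1] the
    identity is the sum of the complementary idempotents [d h] and [h d].
    If [h d] splits in degree [i] through an object [N^i], then [d] embeds
    [N^i] into [C^(i+1)] as the image of [d h], and under (1) the complement
    [N^(i+1)] splits [h d] in degree [i + 1].  As [C] is bounded below, the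
    induction starts with zero objects, and [C] is the direct sum of the
    complexes [id_(N^i)[-i]].  Conversely, a retraction [p] of [i : X -> Y]
    gives the contractible complex [X -> Y -> Y -> X] with differentials
    [i], [1 - i p], [p]; if it splits, then in degree 1 the summand
    [id_N[-1]] is a complement of [i]. *)

Set Implicit Arguments.
Unset Strict Implicit.
Unset Printing Implicit Defensive.

Import Order.TTheory GRing.Theory Num.Theory.

Local Open Scope ring_scope.
Local Open Scope cat_scope.

(** * Biproducts and complements *)

Section Biproducts.
Variable A : preAddCat.
Implicit Types X Y Z U V W S T : A.

Lemma isomorphic_refl X : isomorphic X X.
Proof. by exists (idm X), (idm X); rewrite comp1m. Qed.

Lemma isomorphic_sym X Y : isomorphic X Y -> isomorphic Y X.
Proof. by move=> [f [g [gf fg]]]; exists g, f. Qed.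

Lemma pr1_in1A X Y S W (b : biproduct X Y S) (f : hom W X) :
  pr1 b ∘ (in1 b ∘ f) = f.
Proof. by rewrite compmA pr1_in1 comp1m. Qed.

Lemma pr2_in2A X Y S W (b : biproduct X Y S) (f : hom W Y) :
  pr2 b ∘ (in2 b ∘ f) = f.
Proof. by rewrite compmA pr2_in2 comp1m. Qed.

Lemma pr1_in2A X Y S W (b : biproduct X Y S) (f : hom W Y) :
  pr1 b ∘ (in2 b ∘ f) = 0.
Proof. by rewrite compmA pr1_in2 comp0m. Qed.

Lemma pr2_in1A X Y S W (b : biproduct X Y S) (f : hom W X) :
  pr2 b ∘ (in1 b ∘ f) = 0.
Proof. by rewrite compmA pr2_in1 comp0m. Qed.

(** Rewriting with this rule after reassociating to the right brings every
    composite of injections and projections into normal form. *)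
Definition biproductE := (@compDl A, @compDr A, @pr1_in1 A, @pr2_in2 A,
  @pr1_in2 A, @pr2_in1 A, pr1_in1A, pr2_in2A, pr1_in2A, pr2_in1A, @comp0m A,
  @compm0 A, @comp1m A, @compm1 A, @addr0, @add0r).

Definition biproduct_sym X Y S (b : biproduct X Y S) : biproduct Y X S.
Proof.
apply: (@Biproduct _ _ _ _ (in2 b) (in1 b) (pr2 b) (pr1 b));
  rewrite ?biproductE //.
by rewrite addrC in_pr.
Defined.

Lemma biproduct_iso X Y S X' Y' S' (b : biproduct X Y S)
    (u : hom X' X) (u' : hom X X') (v : hom Y' Y) (v' : hom Y Y')
    (w : hom S S') (w' : hom S' S) :
    u' ∘ u = idm X' -> u ∘ u' = idm X ->
    v' ∘ v = idm Y' -> v ∘ v' = idm Y ->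
    w ∘ w' = idm S' -> w' ∘ w = idm S ->
  exists b' : biproduct X' Y' S',
    in1 b' = w ∘ (in1 b ∘ u) /\ pr1 b' = u' ∘ (pr1 b ∘ w').
Proof.
move=> u1 u2 v1 v2 w1 w2.
have w2A W (f : hom W S) : w' ∘ (w ∘ f) = f by rewrite compmA w2 comp1m.
have u2A W (f : hom W X) : u ∘ (u' ∘ f) = f by rewrite compmA u2 comp1m.
have v2A W (f : hom W Y) : v ∘ (v' ∘ f) = f by rewrite compmA v2 comp1m.
unshelve eexists (@Biproduct _ _ _ _ (w ∘ (in1 b ∘ u)) (w ∘ (in2 b ∘ v))
  (u' ∘ (pr1 b ∘ w')) (v' ∘ (pr2 b ∘ w')) _ _ _ _ _); last by [].
all: rewrite -?compmA ?(w2A, biproductE) //.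
rewrite u2A v2A -compDr [in1 b ∘ _]compmA [in2 b ∘ _]compmA -compDl in_pr.
by rewrite comp1m.
Qed.

Lemma biproduct_isomorphic X Y S X' Y' S' :
    isomorphic X X' -> isomorphic Y Y' -> isomorphic S S' ->
  biproduct X Y S -> inhabited (biproduct X' Y' S').
Proof.
move=> [u [u' [u1 u2]]] [v [v' [v1 v2]]] [w [w' [w1 w2]]] b.
by have [b' _] := biproduct_iso b u2 u1 v2 v1 w2 w1; exists.
Qed.

Lemma biproduct_uniq X Y S S' :
  biproduct X Y S -> biproduct X Y S' -> isomorphic S S'.
Proof.
move=> b b'; exists (in1 b' ∘ pr1 b + in2 b' ∘ pr2 b).
exists (in1 b ∘ pr1 b' + in2 b ∘ pr2 b').
by split; rewrite !biproductE -!compmA !biproductE in_pr.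
Qed.

(** Both [Y] and [Y'] are cokernels of the same morphism. *)
Lemma complement_uniq X Y Y' S (b : biproduct X Y S) (b' : biproduct X Y' S) :
  in1 b = in1 b' -> isomorphic Y Y'.
Proof.
move=> bb'; exists (pr2 b' ∘ in2 b), (pr2 b ∘ in2 b').
have e : in2 b ∘ pr2 b = idm S - in1 b ∘ pr1 b.
  by rewrite -(in_pr b) addrC addKr.
have e' : in2 b' ∘ pr2 b' = idm S - in1 b' ∘ pr1 b'.
  by rewrite -(in_pr b') addrC addKr.
split; rewrite -compmA [in2 _ ∘ _]compmA ?e ?e' compDl compNm compDr compmN.
  by rewrite comp1m -bb' -!compmA !biproductE oppr0 addr0.
by rewrite comp1m bb' -!compmA !biproductE oppr0 addr0.
Qed.

(** The regrouping [X + (Y + Z) = Y + (X + Z)]; together with symmetry it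
    replaces associativity. *)
Definition biproductCA X Y Z YZ XZ S (b1 : biproduct Y Z YZ)
    (b2 : biproduct X YZ S) (b3 : biproduct X Z XZ) : biproduct Y XZ S.
Proof.
apply: (@Biproduct _ _ _ _ (in2 b2 ∘ in1 b1)
  (in1 b2 ∘ pr1 b3 + in2 b2 ∘ (in2 b1 ∘ pr2 b3)) (pr1 b1 ∘ pr2 b2)
  (in1 b3 ∘ pr1 b2 + in2 b3 ∘ (pr2 b1 ∘ pr2 b2)));
  rewrite -?compmA ?biproductE -?compmA ?biproductE ?in_pr //.
rewrite addrCA -compDr compmA [in2 b1 ∘ _]compmA -!compDl in_pr.
by rewrite comp1m in_pr.
Defined.

(** The retraction may be prescribed: any section [a] of the cokernel [b] of
    [i] can be corrected to [(1 - i p) a], which [p] kills. The equation with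
    [w] makes [i] and [a] jointly epimorphic. *)
Lemma biproduct_split X Y Z (i : hom X Y) (p w : hom Y X) (a : hom Z Y)
    (b : hom Y Z) :
    p ∘ i = idm X -> b ∘ a = idm Z -> b ∘ i = 0 ->
    i ∘ w + a ∘ b = idm Y ->
  exists c : biproduct X Z Y, in1 c = i /\ pr1 c = p.
Proof.
move=> pi ba bi e.
unshelve eexists (@Biproduct _ _ _ _ i (a - i ∘ (p ∘ a)) p b _ _ _ _ _) => //.
- by rewrite compDr compmN compmA bi comp0m oppr0 addr0.
- by rewrite compDr compmN compmA pi comp1m subrr.
have {}e : a ∘ b = idm Y - i ∘ w by rewrite -e addrC addKr.
rewrite compDl compNm -!compmA e !compDr !compmN compm1.
rewrite [p ∘ (i ∘ w)]compmA pi comp1m.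
by rewrite opprB addrC addrA !subrK.
Qed.

(** The definition only provides some retraction of [i] as the projection of
    a biproduct; [biproduct_split] replaces it by the given one. *)
Lemma weakly_idempotent_completeP :
  weakly_idempotent_complete A <->
  forall X Y (i : hom X Y) (p : hom Y X), p ∘ i = idm X ->
    exists Z (b : biproduct X Z Y), in1 b = i /\ pr1 b = p.
Proof.
split=> [wic X Y i p pi|wic X Y i [p /wic[Z [b [bi _]]]]]; last first.
  exists Z, Y, b; exists (idm X), (idm Y).
  by rewrite bi comp1m compm1; split=> //; exists (idm _); rewrite comp1m.
have [|Z [S [b [u [v [[u' [u1 u2]] [v' [v1 v2]] vi]]]]]] := wic _ _ i.
  by exists p.
exists Z; have ei : i = v' ∘ (in1 b ∘ u) by rewrite -vi compmA v1 comp1m.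
apply: (@biproduct_split _ _ _ i p (u' ∘ (pr1 b ∘ v)) (v' ∘ in2 b)
  (pr2 b ∘ v)).
- exact: pi.
- by rewrite -compmA (compmA v) v2 comp1m pr2_in2.
- by rewrite -compmA vi compmA pr2_in1 comp0m.
rewrite ei -!compmA (compmA u) u2 comp1m -compDr !compmA -!compDl.
by rewrite [_ ∘ v](_ : _ = v) // in_pr comp1m.
Qed.

Lemma idempotent_complete_weakly :
  idempotent_complete A -> weakly_idempotent_complete A.
Proof.
move=> ic; apply/weakly_idempotent_completeP => X Y i p pi.
have [|U [Z [b eb]]] := ic Y (i ∘ p).
  by rewrite compmA -[_ ∘ p ∘ i]compmA pi compm1.
exists Z; apply: (@biproduct_split _ _ _ i p p (in2 b) (pr2 b)) => //.
- by rewrite pr2_in2.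
- have -> : i = in1 b ∘ (pr1 b ∘ i) by rewrite compmA -eb -compmA pi compm1.
  by rewrite compmA pr2_in1 comp0m.
by rewrite eb in_pr.
Qed.

Lemma wKar_inP (P : A -> Prop) Z :
  wKar_in P Z <-> exists X Y, [/\ P X, P Y & inhabited (biproduct X Z Y)].
Proof.
split=> [[X [Y [PX PY [S [b SY]]]]]|[X [Y [PX PY [b]]]]]; exists X, Y.
  split=> //.
  exact: biproduct_isomorphic (isomorphic_refl _) (isomorphic_refl _) SY b.
by split=> //; exists Y, b; apply: isomorphic_refl.
Qed.

Lemma sub_wKar_in (P Q : A -> Prop) Z :
  (forall X, P X -> Q X) -> wKar_in P Z -> wKar_in Q Z.
Proof. by move=> PQ [X [Y [/PQ QX /PQ QY h]]]; exists X, Y. Qed.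

End Biproducts.

(** If [U + Z = V], [X + U = Y] and [X' + V = Y'] with [X, X', Y, Y'] in [P],
    then adding [X + X'] to the first identity gives
    [(X' + Y) + Z = X + Y']. *)
Lemma wKar_in_idem (A : addCat) (P : A -> Prop) :
    (forall X Y, P X -> P Y -> exists S, P S /\ inhabited (biproduct X Y S)) ->
  forall Z, wKar_in (wKar_in P) Z -> wKar_in P Z.
Proof.
move=> PD Z /wKar_inP[U [V [/wKar_inP[X [Y [PX PY [bU]]]]]]].
move=> /wKar_inP[X' [Y' [PX' PY' [bV]]]] [b]; apply/wKar_inP.
have [T [PT [bT]]] := PD _ _ PX' PY; have [W [PW [bW]]] := PD _ _ PX PY'.
have [R1 [b1]] := has_biproduct X' U; have [R2 [b2]] := has_biproduct X R1.
have bZ := biproductCA (biproductCA (biproduct_sym b) bV b1) bW b2.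
exists T, W; split=> //.
apply: biproduct_isomorphic (biproduct_sym bZ); try exact: isomorphic_refl.
exact: biproduct_uniq (biproductCA b1 b2 bU) bT.
Qed.

(** * Fully faithful functors and retraction-closure *)

Section FullyFaithful.
Variables (A K : preAddCat) (F : functor A K).
Implicit Types X Y Z S : A.

Lemma fmor_biproduct X Y S (b : biproduct X Y S) :
  exists b' : biproduct (F X) (F Y) (F S), in1 b' = fmor F (in1 b).
Proof.
unshelve eexists (@Biproduct _ _ _ _ (fmor F (in1 b)) (fmor F (in2 b))
  (fmor F (pr1 b)) (fmor F (pr2 b)) _ _ _ _ _); last by [].
all: rewrite -?fmorM ?biproductE ?fmor1 ?raddf0 //.
by rewrite -raddfD in_pr fmor1.
Qed.

Lemma ob_image_biproduct Z Z' :
    (exists S, inhabited (biproduct Z Z' S)) ->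
  exists T, ob_image F T /\ inhabited (biproduct (F Z) (F Z') T).
Proof.
move=> [S [b]]; exists (F S); split; first by exists S.
by have [b' _] := fmor_biproduct b; exists.
Qed.

Lemma fmor_isomorphic X Y : isomorphic X Y -> isomorphic (F X) (F Y).
Proof.
move=> [f [g [gf fg]]]; exists (fmor F f), (fmor F g).
by rewrite -!fmorM gf fg !fmor1.
Qed.

Hypotheses (Ffull : full F) (Ffaith : faithful F).

Lemma full_biproduct X Y S (b : biproduct (F X) (F Y) (F S)) :
  exists b' : biproduct X Y S,
    fmor F (in1 b') = in1 b /\ fmor F (pr1 b') = pr1 b.
Proof.
have [i1 e1] := Ffull (in1 b); have [i2 e2] := Ffull (in2 b).
have [p1 q1] := Ffull (pr1 b); have [p2 q2] := Ffull (pr2 b).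
unshelve eexists (@Biproduct _ _ _ _ i1 i2 p1 p2 _ _ _ _ _); last by [].
all: apply: Ffaith; rewrite ?raddfD ?raddf0 /= ?fmorM ?e1 ?e2 ?q1 ?q2.
all: by rewrite ?biproductE ?fmor1 ?in_pr.
Qed.

(** A complement [Z] of [F X] in [F Y] is a complement of the image of a
    split monomorphism of [A], whose complement in [A] is sent to an object
    isomorphic to [Z]. *)
Lemma wKar_in_weakly_idempotent_complete :
    weakly_idempotent_complete A ->
  forall Z : K, wKar_in (ob_image F) Z -> exists X, isomorphic (F X) Z.
Proof.
move=> /weakly_idempotent_completeP wic Z /wKar_inP[_ [_ [[X <-] [Y <-] [b]]]].
have [i ei] := Ffull (in1 b); have [p ep] := Ffull (pr1 b).
have [|Z' [b' [bi _]]] := wic _ _ i p.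
  by apply: Ffaith; rewrite fmorM ei ep pr1_in1 fmor1.
have [b'' b''i] := fmor_biproduct b'.
by exists Z'; apply: (@complement_uniq _ _ _ _ _ b'' b); rewrite b''i bi ei.
Qed.

(** Conversely, the complement in [K] of the image of a split monomorphism of
    [A] belongs to [wKar_in (ob_image F)] by definition. *)
Lemma weakly_idempotent_complete_wKar_in :
    weakly_idempotent_complete K ->
    (forall Z : K, wKar_in (ob_image F) Z -> exists X, isomorphic (F X) Z) ->
  weakly_idempotent_complete A.
Proof.
move=> /weakly_idempotent_completeP wic FwKar.
apply/weakly_idempotent_completeP => X Y i p pi.
have [|Z [b [bi bp]]] := wic _ _ (fmor F i) (fmor F p).
  by rewrite -fmorM pi fmor1.
have [|Z' [f [g [gf fg]]]] := FwKar Z.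
  by apply/wKar_inP; exists (F X), (F Y); split=> //; [exists X|exists Y].
have [||||||b1 [b1i b1p]] := biproduct_iso b (u := idm _) (u' := idm _)
  (v := f) (v' := g) (w := idm _) (w' := idm _); rewrite ?comp1m //.
have [b2 [b2i b2p]] := full_biproduct b1.
exists Z', b2; split; apply: Ffaith.
  by rewrite b2i b1i comp1m compm1.
by rewrite b2p b1p comp1m compm1.
Qed.

(** Both halves of the decomposition of an idempotent are lifted along [F]. *)
Lemma idempotent_complete_ess_surj :
    (forall Z : K, exists X, isomorphic (F X) Z) ->
  idempotent_complete K -> idempotent_complete A.
Proof.
move=> Fsurj ic X p pp.
have [|U [V [b bp]]] := ic (F X) (fmor F p); first by rewrite -fmorM pp.
have [U' [f [f' [f1 f2]]]] := Fsurj U; have [V' [g [g' [g1 g2]]]] := Fsurj V.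
have [||||||b1 [b1i b1p]] := biproduct_iso b (u := f) (u' := f')
  (v := g) (v' := g') (w := idm _) (w' := idm _); rewrite ?comp1m //.
have [b2 [b2i b2p]] := full_biproduct b1.
exists U', V', b2; apply: Ffaith.
rewrite fmorM b2i b2p b1i b1p comp1m compm1 bp.
by rewrite compmA -[_ ∘ f ∘ f']compmA f2 compm1.
Qed.

Section Inverse.
Hypothesis Fsurj : forall Z : K, exists X, isomorphic (F X) Z.

Let G (Z : K) : A := sval (cid (Fsurj Z)).
Let e_ex (Z : K) :
  {e : hom (F (G Z)) Z & {e' : hom Z (F (G Z)) |
    e' ∘ e = idm _ /\ e ∘ e' = idm _}}.
Proof.
have /cid[e /cid[e' h]] := svalP (cid (Fsurj Z)).
by exists e, e'.
Qed.
Let e (Z : K) : hom (F (G Z)) Z := projT1 (e_ex Z).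
Let e' (Z : K) : hom Z (F (G Z)) := sval (projT2 (e_ex Z)).
Let e'e (Z : K) : e' Z ∘ e Z = idm _ := proj1 (svalP (projT2 (e_ex Z))).
Let ee' (Z : K) : e Z ∘ e' Z = idm _ := proj2 (svalP (projT2 (e_ex Z))).

Let gmor (Z Z' : K) (f : hom Z Z') : hom (G Z) (G Z') :=
  sval (cid (Ffull (e' Z' ∘ f ∘ e Z))).
Let gmorE (Z Z' : K) (f : hom Z Z') : fmor F (gmor f) = e' Z' ∘ f ∘ e Z :=
  svalP (cid (Ffull (e' Z' ∘ f ∘ e Z))).

Let gmor_zmod (Z Z' : K) : zmod_morphism (@gmor Z Z').
Proof.
move=> f g; apply: Ffaith.
by rewrite raddfB /= !gmorE compDr compDl compmN compNm.
Qed.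

HB.instance Definition _ (Z Z' : K) :=
  GRing.isZmodMorphism.Build (hom Z Z') (hom (G Z) (G Z')) (@gmor Z Z')
    (@gmor_zmod Z Z').

Let gmor1 (Z : K) : gmor (idm Z) = idm (G Z).
Proof. by apply: Ffaith; rewrite gmorE fmor1 compm1 e'e. Qed.

Let gmorM (X Y Z : K) (g : hom Y Z) (f : hom X Y) :
  gmor (g ∘ f) = gmor g ∘ gmor f.
Proof.
apply: Ffaith; rewrite fmorM !gmorE -!compmA; congr (_ ∘ (_ ∘ _)).
by rewrite (compmA (e Y)) ee' comp1m.
Qed.

(** The quasi-inverse sends [Z] to a chosen object [G Z] with an isomorphism
    [e Z : F (G Z) -> Z], and a morphism to the unique preimage of its
    conjugate by these isomorphisms; [e] itself is one natural isomorphism,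
    and the preimages of the [e (F X)] form the other. *)
Lemma is_equivalence_ess_surj : is_equivalence F.
Proof.
exists (@Functor K A G (fun Z Z' : K => @gmor Z Z') gmor1 gmorM); split.
  pose h X := sval (cid (Ffull (e (F X)))).
  have hE X : fmor F (h X) = e (F X) := svalP (cid (Ffull (e (F X)))).
  exists h; split=> [X|X Y f].
    have [h' h'E] := Ffull (e' (F X)).
    by exists h'; split; apply: Ffaith; rewrite fmorM hE h'E ?e'e ?ee' fmor1.
  by apply: Ffaith; rewrite /= !fmorM hE hE gmorE !compmA ee' comp1m.
exists e; split=> [Z|Z Z' f] /=; first by exists (e' Z).
by rewrite gmorE !compmA ee' comp1m.
Qed.

End Inverse.
End FullyFaithful.

Lemma nat_iso_id_faithful (A K : preAddCat) (F : functor A K)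
    (G : functor K A) :
  nat_iso (functor_comp G F) (functor_id A) -> faithful F.
Proof.
move=> [h [hiso hnat]] X Y f f' ff'.
have [g [gh hg]] := hiso X.
rewrite -[f]compm1 -[f']compm1 -hg !compmA.
by rewrite -[f ∘ _](hnat X Y f) -[f' ∘ _](hnat X Y f') /= ff'.
Qed.

(** Fullness of [F] comes from the faithfulness of its quasi-inverse: the
    naturality square of the isomorphism of [G F] with the identity forces the
    preimage of [g], and [G] detects that it is one. *)
Lemma is_equivalenceP (A K : preAddCat) (F : functor A K) :
  is_equivalence F ->
  [/\ full F, faithful F & forall Z : K, exists X, isomorphic (F X) Z].
Proof.
move=> [G [GF FG]]; have Gf := nat_iso_id_faithful FG.
split; last 1 first.
- by move=> Z; have [h [hiso _]] := FG; exists (G Z), (h Z); exact: hiso.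
- move=> X Y g; have [h [hiso hnat]] := GF.
  have [hX [h1 h2]] := hiso X; have [hY [k1 k2]] := hiso Y.
  exists (h Y ∘ fmor G g ∘ hX); apply: Gf.
  rewrite -[LHS]comp1m -k1 -[hY ∘ h Y ∘ _]compmA.
  by rewrite (hnat X Y) /= -!compmA h1 compm1 compmA k1 comp1m.
exact: nat_iso_id_faithful GF.
Qed.

(** * The idempotent completion *)

Section Karoubi.
Variable A : addCat.

Lemma kar_idemK (P Q : Kar A) (f : hom P Q) :
  kidem Q ∘ kval f = kval f /\ kval f ∘ kidem P = kval f.
Proof. by have /andP[/eqP ? /eqP] := kvalP f. Qed.

Lemma kar_has_zero : exists P : Kar A, is_zero P.
Proof.
exists (kar_emb A (zero_ob A)) => Q.
by split=> f; apply: kar_homP;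
  [apply: (zero_obP _).1 | apply: (zero_obP _).2].
Qed.

Lemma kar_has_biproduct (P Q : Kar A) : exists S, inhabited (biproduct P Q S).
Proof.
have [T [b]] := has_biproduct (kob P) (kob Q).
pose e := in1 b ∘ (kidem P ∘ pr1 b) + in2 b ∘ (kidem Q ∘ pr2 b).
have ee : e ∘ e = e.
  rewrite /e !biproductE -!compmA !biproductE.
  by rewrite !(compmA (kidem _) (kidem _)) !kidemP.
pose S : Kar A := KarOb ee.
have hi1 : @kar_pred _ P S (in1 b ∘ kidem P).
  rewrite /kar_pred /= /e !biproductE -!compmA !biproductE.
  by rewrite !kidemP !eqxx.
have hi2 : @kar_pred _ Q S (in2 b ∘ kidem Q).
  rewrite /kar_pred /= /e !biproductE -!compmA !biproductE.
  by rewrite !kidemP !eqxx.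
have hp1 : @kar_pred _ S P (kidem P ∘ pr1 b).
  rewrite /kar_pred /= /e !biproductE -!compmA !biproductE.
  by rewrite !(compmA (kidem _) (kidem _)) !kidemP !eqxx.
have hp2 : @kar_pred _ S Q (kidem Q ∘ pr2 b).
  rewrite /kar_pred /= /e !biproductE -!compmA !biproductE.
  by rewrite !(compmA (kidem _) (kidem _)) !kidemP !eqxx.
exists S; split; apply: (@Biproduct (Kar A) P Q S (KarHom hi1) (KarHom hi2)
  (KarHom hp1) (KarHom hp2)); apply: kar_homP;
  rewrite /= -?compmA ?biproductE ?kidemP ?compm0 //.
by rewrite !(compmA (kidem _) (kidem _)) !kidemP.
Qed.

Definition Kar_addCat : addCat := AddCat kar_has_zero kar_has_biproduct.

(** An idempotent [p] of [(X, e)] decomposes it into [(X, p)] and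
    [(X, e - p)]. *)
Lemma Kar_idempotent_complete : idempotent_complete (Kar A).
Proof.
move=> P p /(congr1 (@kval _ _ _)) /= pp.
have [ep pe] := kar_idemK p.
pose q : hom (kob P) (kob P) := kidem P - kval p.
have qq : q ∘ q = q.
  rewrite /q compDl !compDr !compNm !compmN kidemP ep pe pp opprK.
  by rewrite addNr addr0.
have pq : kval p ∘ q = 0 by rewrite /q compDr compmN pe pp subrr.
have qp : q ∘ kval p = 0 by rewrite /q compDl compNm ep pp subrr.
have eq : kidem P ∘ q = q by rewrite /q compDr compmN kidemP ep.
have qe : q ∘ kidem P = q by rewrite /q compDl compNm kidemP pe.
pose Y : Kar A := KarOb pp; pose Z : Kar A := KarOb qq.
have hYP : @kar_pred _ Y P p by rewrite /kar_pred /= ep pp !eqxx.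
have hPY : @kar_pred _ P Y p by rewrite /kar_pred /= pe pp !eqxx.
have hZP : @kar_pred _ Z P q by rewrite /kar_pred /= eq qq !eqxx.
have hPZ : @kar_pred _ P Z q by rewrite /kar_pred /= qe qq !eqxx.
exists Y, Z.
unshelve eexists (@Biproduct (Kar A) Y Z P (KarHom hYP) (KarHom hZP)
  (KarHom hPY) (KarHom hPZ) _ _ _ _ _); apply: kar_homP => //=.
by rewrite pp qq /q addrC subrK.
Qed.

Lemma kar_emb_full : full (kar_emb A).
Proof. by move=> X Y g; exists (kval g); apply: kar_homP. Qed.

Lemma kar_emb_faithful : faithful (kar_emb A).
Proof. by move=> X Y f g /(congr1 (@kval _ _ _)). Qed.

End Karoubi.

Section Induced.
Variables (A : preAddCat) (O : Type) (r : O -> A).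

(** An element of [O] is a new name for an object of [A]; unlike a predicate
    on [A], this allows the names to form any type. *)
Definition induced : preAddCat :=
  @PreAddCat O (fun U V => hom (r U) (r V)) (fun U => idm (r U))
    (fun U V W => @comp A (r U) (r V) (r W))
    (fun U V => @comp1m A (r U) (r V)) (fun U V => @compm1 A (r U) (r V))
    (fun U V W T => @compmA A (r U) (r V) (r W) (r T))
    (fun U V W => @compDl A (r U) (r V) (r W))
    (fun U V W => @compDr A (r U) (r V) (r W)).

Definition induced_fun : functor induced A :=
  @Functor induced A r (fun U V => idfun) (fun U => erefl)
    (fun U V W g f => erefl).

Lemma induced_full : full induced_fun.
Proof. by move=> U V g; exists g. Qed.

Lemma induced_faithful : faithful induced_fun.
Proof. by move=> U V f g. Qed.

End Induced.

Definition sub_fun (A : preAddCat) (P : A -> Prop) :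
    functor (full_subcat P) A :=
  @Functor (full_subcat P) A sval (fun U V => idfun) (fun U => erefl)
    (fun U V W g f => erefl).

Lemma ob_image_sub_fun (A : preAddCat) (P : A -> Prop) Z :
  ob_image (sub_fun P) Z <-> P Z.
Proof. by split=> [[[X PX] <-]//|PZ]; exists (exist _ Z PZ). Qed.

(** Complements exist in the whole idempotent completion, and they stay in
    [wKar A] because taking [wKar_in] twice adds nothing. *)
Lemma wKar_weakly_idempotent_complete (A : addCat) :
  weakly_idempotent_complete (wKar A).
Proof.
apply: (@weakly_idempotent_complete_wKar_in _ _ (sub_fun _)).
- by move=> X Y g; exists g.
- by move=> X Y f g.
- exact/idempotent_complete_weakly/Kar_idempotent_complete.
move=> Z /(sub_wKar_in (fun X => iffLR (@ob_image_sub_fun _ _ X))) hZ.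
have PZ : wKar_in (ob_image (kar_emb A)) Z.
  apply: (@wKar_in_idem (Kar_addCat A)) hZ => _ _ [X <-] [Y <-].
  exact/ob_image_biproduct/has_biproduct.
by exists (exist _ Z PZ); apply: isomorphic_refl.
Qed.

(** * A strict model of the idempotent completion *)

Section Strictification.
Variable A : addCat.

(** To make the image of [A] closed under isomorphism, the objects of [Kar A]
    that are isomorphic to an object of [A] are replaced by the objects of
    [A]. *)
Definition strict_ob : Type :=
  (A + {P : Kar A | ~ exists X, isomorphic (kar_emb A X) P})%type.

Definition strict_real (U : strict_ob) : Kar A :=
  match U with inl X => kar_emb A X | inr P => sval P end.

Definition strict_preKar : preAddCat := induced strict_real.

Lemma strict_real_surj (P : Kar A) :
  exists U : strict_preKar, isomorphic (induced_fun strict_real U) P.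
Proof.
have [[X XP]|nP] := pselect (exists X, isomorphic (kar_emb A X) P).
  by exists (inl X).
by exists (inr (exist _ P nP)); apply: isomorphic_refl.
Qed.

Lemma strict_has_zero : exists U : strict_preKar, is_zero U.
Proof.
exists (inl (zero_ob A)) => V.
by split=> f; apply: kar_homP;
  [apply: (zero_obP _).1 | apply: (zero_obP _).2].
Qed.

Lemma strict_has_biproduct (U V : strict_preKar) :
  exists S, inhabited (biproduct U V S).
Proof.
have [T [b]] := @has_biproduct (Kar_addCat A) (strict_real U) (strict_real V).
have [S ST] := strict_real_surj T; exists S.
have [b'] := biproduct_isomorphic (isomorphic_refl _) (isomorphic_refl _)
  (isomorphic_sym ST) b.
have [b'' _] := @full_biproduct _ _ (induced_fun strict_real)
  (@induced_full _ _ _) (@induced_faithful _ _ _) _ _ _ b'.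
by exists.
Qed.

Definition strict_Kar : addCat := AddCat strict_has_zero strict_has_biproduct.

Lemma strict_Kar_idempotent_complete : idempotent_complete strict_Kar.
Proof.
apply: (@idempotent_complete_ess_surj _ _ (induced_fun strict_real)).
- exact: induced_full.
- exact: induced_faithful.
- exact: strict_real_surj.
exact: Kar_idempotent_complete.
Qed.

Definition strict_emb : functor A strict_Kar :=
  @Functor A strict_Kar inl (fun X Y => fmor (kar_emb A))
    (fmor1 (kar_emb A)) (fmorM (kar_emb A)).

Lemma strict_embP : strictly_full_embedding strict_emb.
Proof.
split; first split.
- by move=> X Y [].
- by move=> X Y g; have [f fg] := kar_emb_full g; exists f.
- by move=> X Y; apply: kar_emb_faithful.
move=> U [X|[P nP]] UV [Y YU]; first by exists X.
subst U; apply: False_ind; apply: (nP); exists Y.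
exact: (fmor_isomorphic (induced_fun strict_real) UV).
Qed.

End Strictification.

(** * Retraction-closed images *)

Lemma weakly_retraction_closed_image (A : addCat) (K : addCat)
    (F : functor A K) :
    strictly_full_embedding F -> weakly_idempotent_complete A ->
  weakly_retraction_closed (ob_image F).
Proof.
move=> [[_ Ffull Ffaith] Fstrict] wic Z; split=> [hZ|[X <-]].
  have [X XZ] := wKar_in_weakly_idempotent_complete Ffull Ffaith wic hZ.
  by apply: Fstrict XZ _; exists X.
have [S [b]] := has_biproduct X X; have [b' _] := fmor_biproduct F b.
apply/wKar_inP; exists (F X), (F S); split; [by exists X|by exists S|by exists].
Qed.

Lemma wkar_emb_equivalence (A : addCat) :
  weakly_idempotent_complete A -> is_equivalence (wkar_emb A).
Proof.
move=> wic; apply: is_equivalence_ess_surj.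
- by move=> X Y g; have [f fg] := kar_emb_full g; exists f.
- by move=> X Y; apply: kar_emb_faithful.
move=> [Z hZ].
have [X XZ] := wKar_in_weakly_idempotent_complete (@kar_emb_full A)
  (@kar_emb_faithful A) wic hZ.
by exists X; have [f [g fg]] := XZ; exists f, g.
Qed.

(** * Contractible complexes and two-term complexes *)

Lemma zero_hom_eq (A : preAddCat) (X Y : A) (f g : hom X Y) :
  is_zero X \/ is_zero Y -> f = g.
Proof.
by case=> h; [rewrite (etrans ((h Y).1 f) (esym ((h Y).1 g)))
  | rewrite (etrans ((h X).2 f) (esym ((h X).2 g)))].
Qed.

Lemma Kb_class0 (A : preAddCat) (C D : complex A) :
  Kb_class (0 : chain_map C D) = 0.
Proof. by apply: (addrI (Kb_class 0)); rewrite -Kb_classD !addr0. Qed.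

Lemma contractibleP (A : preAddCat) (C : complex A) :
  contractible C <-> null_homotopic (chain_id C).
Proof.
split=> [C0|h].
  have : Kb_class (chain_id C) = 0 := (C0 C).1 (idm (C : Kb A)).
  by rewrite -Kb_class0 => /Kb_classP; rewrite subr0.
have id0 : idm (C : Kb A) = 0.
  by rewrite -[RHS]Kb_class0; apply/Kb_classP; rewrite subr0.
move=> D; split=> f; first by rewrite -[f]compm1 id0 compm0.
by rewrite -[f]comp1m id0 comp0m.
Qed.

Lemma comp_suml (A : preAddCat) (X Y Z : A) (I : Type) (s : seq I)
    (Q : pred I) (g : I -> hom Y Z) (f : hom X Y) :
  (\sum_(k <- s | Q k) g k) ∘ f = \sum_(k <- s | Q k) g k ∘ f.
Proof.
by apply: (big_morph (fun h : hom Y Z => h ∘ f)) => [h h'|];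
  rewrite ?compDl ?comp0m.
Qed.

Lemma comp_sumr (A : preAddCat) (X Y Z : A) (I : Type) (s : seq I)
    (Q : pred I) (g : hom Y Z) (f : I -> hom X Y) :
  g ∘ (\sum_(k <- s | Q k) f k) = \sum_(k <- s | Q k) g ∘ f k.
Proof. by apply: (big_morph (comp g)) => [h h'|]; rewrite ?compDr ?compm0. Qed.

Definition direct_sum_iso (A : preAddCat) (I : finType) (X : I -> A) (S T : A)
    (s : direct_sum X S) (f : hom S T) (g : hom T S) :
  g ∘ f = idm S -> f ∘ g = idm T -> direct_sum X T.
Proof.
move=> gf fg.
apply: (@DirectSum _ _ _ _ (fun k => f ∘ inj s k) (fun k => proj s k ∘ g)).
- by move=> k; rewrite -compmA (compmA g) gf comp1m proj_inj.
- by move=> k l kl; rewrite -compmA (compmA g) gf comp1m proj_inj_neq.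
under eq_bigr do rewrite compmA -[f ∘ _ ∘ _]compmA.
by rewrite -comp_suml -comp_sumr inj_proj compm1.
Defined.

Lemma addz1_neq (i : int) : (i + 1 == i) = false.
Proof. by apply/negP; rewrite -subr_eq0 addrC addKr. Qed.

Section TwoTermTheory.
Variables (A : addCat) (N : A) (i : int).

Lemma two_term_in_out j : two_term_in N i j ∘ two_term_out N i j = idm _.
Proof.
rewrite /two_term_in /two_term_out /two_term_ob.
case: (_ || _); first by rewrite comp1m.
by apply: zero_hom_eq; left; apply: zero_obP.
Qed.

Lemma two_term_out_in j : (j == i) || (j == i + 1) ->
  two_term_out N i j ∘ two_term_in N i j = idm _.
Proof.
rewrite /two_term_in /two_term_out /two_term_ob.
by case: (_ || _) => // _; rewrite comp1m.
Qed.

Lemma is_zero_two_term j : ~~ ((j == i) || (j == i + 1)) ->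
  is_zero (two_term_ob N i j).
Proof. by rewrite /two_term_ob => /negbTE ->; apply: zero_obP. Qed.

Lemma two_term_diffE :
  two_term_diff N i i = two_term_in N i (i + 1) ∘ two_term_out N i i.
Proof. by rewrite /two_term_diff eqxx. Qed.

Lemma two_term_diff0 j : j != i -> two_term_diff N i j = 0.
Proof. by rewrite /two_term_diff => /negbTE ->. Qed.

Variables (C : complex A).
Variables (u : chain_map (two_term N i) C) (v : chain_map C (two_term N i)).

(** In degrees other than [i] the complex [id_N[-i]] consists of
    boundaries, so there [u v] factors through the differential of [C]. *)
Lemma two_term_boundary j : j + 1 != i ->
  exists w, u (j + 1) ∘ v (j + 1) = diff C j ∘ w.
Proof.
move=> j1i; have [ji|ji] := eqVneq j i; last first.
  exists 0; rewrite compm0 [v _](_ : _ = 0) ?compm0 //.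
  apply: zero_hom_eq; right; apply: is_zero_two_term.
  by rewrite (negbTE j1i) (inj_eq (addIr 1)).
subst j.
pose u0 : hom (two_term_ob N i i) (C i) := u i.
pose u1 : hom (two_term_ob N i (i + 1)) (C (i + 1)) := u (i + 1).
pose v1 : hom (C (i + 1)) (two_term_ob N i (i + 1)) := v (i + 1).
have e :
    u1 ∘ (two_term_in N i (i + 1) ∘ two_term_out N i i) = diff C i ∘ u0.
  by rewrite -two_term_diffE; exact: (cmapP u i).
exists (u0 ∘ (two_term_in N i i ∘ (two_term_out N i (i + 1) ∘ v1))).
rewrite -[LHS]/(u1 ∘ v1) (compmA (diff C i)) -e -!compmA.
rewrite (compmA (two_term_out _ _ i)) two_term_out_in ?eqxx // comp1m.
by rewrite (compmA (two_term_in _ _ _)) two_term_in_out comp1m.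
Qed.

(** The degree [i] part of [id_N[-i]] is not hit by its differential, so the
    component of [v] there kills the boundaries of [C]. *)
Lemma two_term_cycle j : i = j + 1 -> v (j + 1) ∘ diff C j = 0.
Proof.
move=> ij; rewrite (cmapP v j) /= two_term_diff0 ?comp0m //.
by rewrite ij eq_sym addz1_neq.
Qed.

End TwoTermTheory.

Lemma cmap_congr (A : preAddCat) (C D : complex A) (j : int)
    (f g : chain_map C D) :
  f = g -> f j = g j.
Proof. by move=> ->. Qed.

Lemma cmap_sum (A : preAddCat) (C D : complex A) (I : Type) (s : seq I)
    (Q : pred I) (f : I -> chain_map C D) j :
  (\sum_(k <- s | Q k) f k) j = \sum_(k <- s | Q k) f k j.
Proof. by apply: (big_morph (fun g : chain_map C D => g j)). Qed.

(** * The complex of a retraction *)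

Section SplitsRetract.
Variables (B : addCat) (X Y : B) (i : hom X Y) (p : hom Y X).
Hypothesis pi : p ∘ i = idm X.

Definition retract_term (j : int) : B :=
  match j with
  | Posz 0 => X | Posz 1 => Y | Posz 2 => Y | Posz 3 => X
  | _ => zero_ob B
  end.

Definition retract_diff (j : int) :
    hom (retract_term j) (retract_term (j + 1)) :=
  match j with
  | Posz 0 => i | Posz 1 => idm Y - i ∘ p | Posz 2 => p
  | _ => 0
  end.

Definition retract_homotopy (j : int) :
    hom (retract_term (j + 1)) (retract_term j) :=
  match j with
  | Posz 0 => p | Posz 1 => idm Y - i ∘ p | Posz 2 => i
  | _ => 0
  end.

Lemma retract_idem : (idm Y - i ∘ p) ∘ (idm Y - i ∘ p) = idm Y - i ∘ p.
Proof.
rewrite compDl compNm comp1m compDr compm1 compmN compmA.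
by rewrite -[i ∘ p ∘ i]compmA pi compm1 subrr subr0.
Qed.

Fact retract_diff2 j : retract_diff (j + 1) ∘ retract_diff j = 0.
Proof.
case: j => [[|[|[|n]]]|n] /=.
- by rewrite compDl compNm comp1m -compmA pi compm1 subrr.
- by rewrite compDr compmN compm1 compmA pi comp1m subrr.
- by rewrite comp0m.
- by rewrite compm0.
- by rewrite compm0.
Qed.

Fact retract_bounded :
  exists n : int, forall j, n < `|j| -> is_zero (retract_term j).
Proof.
exists 3 => -[[|[|[|[|n]]]]|n] //= _; exact: zero_obP.
Qed.

Definition retract_complex : complex B := Complex retract_diff2 retract_bounded.

(** Read from right to left, the homotopy consists of the same three morphisms
    [i], [1 - i p], [p] as the complex. *)
Lemma retract_contractible : contractible retract_complex.
Proof.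
apply/contractibleP; exists retract_homotopy.
case=> [[|[|[|n]]]|[|n]] /=.
- by rewrite retract_idem addrC subrK.
- by rewrite retract_idem subrK.
- by rewrite comp0m addr0 pi.
- by apply: zero_hom_eq; left; rewrite addn1 /=; apply: zero_obP.
- by rewrite compm0 add0r pi.
by apply: zero_hom_eq; left; apply: zero_obP.
Qed.

(** In degree 1 the summands other than the one starting there factor through
    [i] by [two_term_boundary], and the projection to that one kills [i] by
    [two_term_cycle]; so it is a complement of [i]. *)
Lemma splits_retract : splits retract_complex ->
  exists Z (b : biproduct X Z Y), in1 b = i /\ pr1 b = p.
Proof.
move=> [a [n [N [S [s0 [f [g [gf fg]]]]]]]].
have s := direct_sum_iso s0 fg gf.
pose u (k : 'I_n) : chain_map _ retract_complex := inj s k.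
pose v (k : 'I_n) : chain_map retract_complex _ := proj s k.
have vu k : v k 1 ∘ u k 1 = idm _.
  exact: (cmap_congr 1 (proj_inj s k)).
have uv : \sum_k u k 1 ∘ v k 1 = idm Y.
  rewrite -[RHS](cmap_congr 1 (inj_proj s)).
  by rewrite cmap_sum.
have other (k : 'I_n) : a + k%:Z != 1 -> exists w, u k 1 ∘ v k 1 = i ∘ w.
  by rewrite eq_sym; apply: (@two_term_boundary _ _ _ _ (u k) (v k) 0).
have others (P : pred 'I_n) : (forall k : 'I_n, P k -> a + k%:Z != 1) ->
    exists w, \sum_(k | P k) u k 1 ∘ v k 1 = i ∘ w.
  move=> hP; apply: (big_ind (fun h => exists w, h = i ∘ w)).
  - by exists 0; rewrite compm0.
  - by move=> _ _ [w ->] [w' ->]; exists (w + w'); rewrite compDr.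
  - by move=> k /hP; apply: other.
(* The interval of degrees of the splitting need not contain degree 1. *)
have [k /eqP ak|no] := pickP (fun k : 'I_n => a + k%:Z == 1).
  have [|w ew] := others (fun l => l != k).
    move=> l; apply: contraNneq; rewrite -ak => /addrI [lk].
    exact/eqP/val_inj.
  move: uv; rewrite (bigD1 k) //= ew addrC => uv.
  have kt : (1 == a + k%:Z) || (1 == a + k%:Z + 1) by rewrite ak eqxx.
  exists (N (a + k%:Z)); apply: (@biproduct_split _ _ _ _ i p w
    (u k 1 ∘ two_term_in _ _ 1) (two_term_out _ _ 1 ∘ v k 1)) => //.
  - by rewrite -compmA (compmA (v k 1)) vu comp1m two_term_out_in.
  - by rewrite -compmA (@two_term_cycle _ _ _ _ (v k) 0) ?compm0.
  - by rewrite -compmA (compmA (two_term_in _ _ _)) two_term_in_out comp1m.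
have [|w ew] := others xpredT; first by move=> k _; rewrite no.
exists (zero_ob B); apply: (@biproduct_split _ _ _ _ i p w 0 0) => //.
- by apply: zero_hom_eq; left; apply: zero_obP.
- by rewrite comp0m.
by rewrite comp0m addr0 -ew.
Qed.

End SplitsRetract.

(** * Splitting contractible complexes *)

Section OnlyAt.
Variables (P : int -> zmodType) (i : int) (x : P i).

(** Confines to one place the transport of morphisms along equalities of
    degrees. *)
Definition only_at (j : int) : P j :=
  match i =P j with
  | ReflectT e => eq_rect i (fun l => P l : Type) x j e
  | ReflectF _ => 0
  end.

Lemma only_at_eq : only_at i = x.
Proof. by rewrite /only_at; case: eqP => // e; rewrite eq_axiomK. Qed.

Lemma only_at_neq j : j != i -> only_at j = 0.
Proof. by rewrite /only_at eq_sym; case: eqP. Qed.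

End OnlyAt.

Section ContractibleSplits.
Variables (B : addCat) (C : complex B).
Variable h : forall i : int, hom (C (i + 1)) (C i).
Hypothesis hP : forall i : int,
  idm (C (i + 1)) = diff C i ∘ h i + h (i + 1) ∘ diff C (i + 1).

Lemma homotopy_idem i : diff C i ∘ (h i ∘ (diff C i ∘ h i)) = diff C i ∘ h i.
Proof.
have -> : diff C i ∘ (h i ∘ (diff C i ∘ h i)) =
    (diff C i ∘ h i + h (i + 1) ∘ diff C (i + 1)) ∘ (diff C i ∘ h i).
  rewrite compDl -!compmA (compmA (diff C _) (diff C _)) diff2.
  by rewrite comp0m compm0 addr0.
by rewrite -hP comp1m.
Qed.

(** A splitting of the idempotent [h d] of [C] in degree [i]. *)
Definition splits_at (i : int) (N : B) (u : hom N (C i)) (v : hom (C i) N) :=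
  v ∘ u = idm N /\ u ∘ v = h i ∘ diff C i.

(** The image of [d h] is a copy of [N], embedded by [d u] with retraction
    [v h]; its complement splits [1 - d h = h d]. *)
Lemma splits_at_succ i N (u : hom N (C i)) (v : hom (C i) N) :
    weakly_idempotent_complete B -> splits_at u v ->
  exists N' (u' : hom N' (C (i + 1))) (v' : hom (C (i + 1)) N'),
    splits_at u' v'.
Proof.
move=> /weakly_idempotent_completeP wic [vu uv].
have [|N' [b [b1 b2]]] := wic _ _ (diff C i ∘ u) (v ∘ h i).
  rewrite -!compmA (compmA (h i)) -uv -[u ∘ v ∘ u]compmA vu compm1.
  exact: vu.
exists N', (in2 b), (pr2 b); split; first exact: pr2_in2.
apply: (addrI (in1 b ∘ pr1 b)); rewrite in_pr hP b1 b2.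
by rewrite -!compmA (compmA u) uv -!compmA homotopy_idem.
Qed.

Lemma splits_at_zero i : is_zero (C i) ->
  splits_at (idm (C i)) (idm (C i)).
Proof. by move=> C0; split; apply: zero_hom_eq; left. Qed.

(** Degree [- (m + 1)] lies below the support of [C]. *)
Lemma splits_at_all : weakly_idempotent_complete B ->
  forall i, exists N (u : hom N (C i)) (v : hom (C i) N), splits_at u v.
Proof.
move=> wic i; have [m mP] := bounded C.
have [/mP C0|im] := ltP m `|i|.
  by exists (C i), (idm _), (idm _); apply: splits_at_zero.
suff H (k : nat) : exists N (u : hom N (C (- (m + 1) + k%:Z))) v, splits_at u v.
  have [k ik] : exists k : nat, i = - (m + 1) + k%:Z.
    by exists (absz (i + (m + 1))); lia.
  by rewrite ik; apply: H.
elim: k => [|k [N [u [v uv]]]].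
  exists (C _), (idm _), (idm _); apply: splits_at_zero; apply: mP.
  lia.
have -> : - (m + 1) + k.+1%:Z = - (m + 1) + k%:Z + 1 by lia.
exact: splits_at_succ uv.
Qed.

Variables (N : int -> B) (u : forall i, hom (N i) (C i))
  (v : forall i, hom (C i) (N i)).
Hypothesis uvP : forall i, splits_at (u i) (v i).

Let vu i : v i ∘ u i = idm (N i) := (uvP i).1.
Let uv i : u i ∘ v i = h i ∘ diff C i := (uvP i).2.
Let s i : hom (N i) (C (i + 1)) := diff C i ∘ u i.
Let r (i : int) : hom (C (i + 1)) (N i) := v i ∘ h i.

Let rd (i : int) : r i ∘ diff C i = v i.
Proof. by rewrite /r -compmA -uv compmA vu comp1m. Qed.

Let rs (i : int) : r i ∘ s i = idm _.
Proof. by rewrite /s compmA rd. Qed.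

Let sr (i : int) : s i ∘ r i = diff C i ∘ h i.
Proof. by rewrite /s /r -!compmA (compmA (u i)) uv -!compmA homotopy_idem. Qed.

Let vd (i : int) : v (i + 1) ∘ diff C i = 0.
Proof.
rewrite -[v _]comp1m -vu -(compmA (v _)) uv -!compmA diff2.
by rewrite !compm0.
Qed.

Let ds (i : int) : diff C (i + 1) ∘ s i = 0.
Proof. by rewrite /s compmA diff2 comp0m. Qed.

Let uvsr (i : int) : u (i + 1) ∘ v (i + 1) + s i ∘ r i = idm _.
Proof. by rewrite uv sr hP; apply: addrC. Qed.

(** The homotopy need not satisfy [h h = 0]; orthogonality holds because
    [s r] and [u v] are complementary idempotents. *)
Let ru (i : int) : r i ∘ u (i + 1) = 0.
Proof.
have e : s i ∘ (r i ∘ u (i + 1)) = 0.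
  apply: (addrI (u (i + 1) ∘ (v (i + 1) ∘ u (i + 1)))).
  rewrite (compmA (u _)) (compmA (s i)) -compDl uvsr comp1m -compmA vu.
  by rewrite compm1 addr0.
by rewrite -[r i ∘ _]comp1m -rs -(compmA (r i)) e compm0.
Qed.

(** The inclusion [a i] and the projection [b i] of the summand
    [id_(N i)[-i]], which is concentrated in degrees [i] and [i + 1]. *)
Let a i j : hom (N i) (C j) :=
  only_at (P := fun l => hom (N i) (C l)) (u i) j +
  only_at (P := fun l => hom (N i) (C l)) (s i) j.
Let b i j : hom (C j) (N i) :=
  only_at (P := fun l => hom (C l) (N i)) (v i) j +
  only_at (P := fun l => hom (C l) (N i)) (r i) j.

Let a0 i : a i i = u i.
Proof. by rewrite /a only_at_eq only_at_neq ?addr0 // eq_sym addz1_neq. Qed.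
Let a1 i : a i (i + 1) = s i.
Proof. by rewrite /a only_at_eq only_at_neq ?add0r // addz1_neq. Qed.
Let aN (i j : int) : j != i -> j != i + 1 -> a i j = 0.
Proof. by move=> *; rewrite /a !only_at_neq ?addr0. Qed.
Let b0 i : b i i = v i.
Proof. by rewrite /b only_at_eq only_at_neq ?addr0 // eq_sym addz1_neq. Qed.
Let b1 i : b i (i + 1) = r i.
Proof. by rewrite /b only_at_eq only_at_neq ?add0r // addz1_neq. Qed.
Let bN (i j : int) : j != i -> j != i + 1 -> b i j = 0.
Proof. by move=> *; rewrite /b !only_at_neq ?addr0. Qed.

Let inj_subproof (i j : int) :
  a i (j + 1) ∘ two_term_out (N i) i (j + 1) ∘ two_term_diff (N i) i j =
  diff C j ∘ (a i j ∘ two_term_out (N i) i j).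
Proof.
have [->|ji] := eqVneq j i.
  rewrite two_term_diffE a0 a1 -compmA (compmA (two_term_out _ _ _)).
  by rewrite two_term_out_in ?eqxx ?orbT // comp1m -compmA.
rewrite two_term_diff0 // compm0 compmA.
have [->|ji1] := eqVneq j (i + 1); first by rewrite a1 ds comp0m.
by rewrite aN // compm0 comp0m.
Qed.

Let proj_subproof (i j : int) :
  two_term_in (N i) i (j + 1) ∘ b i (j + 1) ∘ diff C j =
  two_term_diff (N i) i j ∘ (two_term_in (N i) i j ∘ b i j).
Proof.
have [->|ji] := eqVneq j i.
  rewrite two_term_diffE b0 b1 -(compmA _ (r i)) rd.
  rewrite -(compmA _ (two_term_out _ _ _)) (compmA (two_term_out _ _ _)).
  by rewrite two_term_out_in ?eqxx // comp1m.
rewrite two_term_diff0 // comp0m -compmA.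
have [<-|ji1] := eqVneq (j + 1) i; first by rewrite b0 vd compm0.
by rewrite bN ?(inj_eq (addIr 1)) // comp0m compm0.
Qed.

Let inj_map i : chain_map (two_term (N i) i) C :=
  @ChainMap B (two_term (N i) i) C (fun j => a i j ∘ two_term_out (N i) i j)
    (inj_subproof i).
Let proj_map i : chain_map C (two_term (N i) i) :=
  @ChainMap B C (two_term (N i) i) (fun j => two_term_in (N i) i j ∘ b i j)
    (proj_subproof i).

Let out_in_b (i j : int) :
  two_term_out (N i) i j ∘ (two_term_in (N i) i j ∘ b i j) = b i j.
Proof.
rewrite compmA; have [/two_term_out_in ->|] := boolP ((j == i) || (j == i + 1)).
  by rewrite comp1m.
by rewrite negb_or => /andP[ji ji1]; rewrite bN // compm0.
Qed.

Let ba (i j : int) : (j == i) || (j == i + 1) -> b i j ∘ a i j = idm (N i).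
Proof. by case/orP=> /eqP ->; rewrite ?a0 ?a1 ?b0 ?b1. Qed.

Let ba_neq (i i' j : int) : i != i' -> b i j ∘ a i' j = 0.
Proof.
move=> ii'; have [->|ji] := eqVneq j i.
  have [->|ii1] := eqVneq i (i' + 1); last by rewrite aN // compm0.
  by rewrite b0 a1 /s compmA vd comp0m.
have [->|ji1] := eqVneq j (i + 1); last by rewrite bN // comp0m.
have [e|i1i'] := eqVneq (i + 1) i'; first by rewrite -e b1 a0 ru.
by rewrite [a _ _]aN ?compm0 // (inj_eq (addIr 1)).
Qed.

(** The two summands of [C] in degree [i + 1] are the images of [N (i + 1)]
    and of [N i]. *)
Let ab_sum (x i : int) n (k0 k1 : 'I_n) : i = x + k0%:Z -> i + 1 = x + k1%:Z ->
  \sum_(k < n) a (x + k%:Z) (i + 1) ∘ b (x + k%:Z) (i + 1) = idm (C (i + 1)).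
Proof.
move=> ik0 ik1.
have k01 : k0 != k1.
  by apply/eqP => e; move: (addz1_neq i); rewrite ik1 {1}ik0 e eqxx.
rewrite (bigD1 k1) //= (bigD1 k0) //= big1 => [|k /andP[kk1 kk0]].
  have e0 l :
      l = i + 1 -> a l (i + 1) ∘ b l (i + 1) = u (i + 1) ∘ v (i + 1).
    by move=> ->; rewrite a0 b0.
  have e1 l : l = i -> a l (i + 1) ∘ b l (i + 1) = s i ∘ r i.
    by move=> ->; rewrite a1 b1.
  by rewrite (e0 _ (esym ik1)) (e1 _ (esym ik0)) addr0 uvsr.
rewrite aN ?comp0m //.
  by rewrite ik1; apply: contraNneq kk1 => /addrI[/val_inj ->].
by rewrite (inj_eq (addIr 1)) ik0; apply: contraNneq kk0 => /addrI[/val_inj ->].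
Qed.

Lemma splits_of_splits_at : splits C.
Proof.
have [m mP] := bounded C; pose M := absz m.
(* A nonzero term in degree [j] has [- M <= j <= M], and it involves the
   summands [j - 1] and [j]: hence the range from [- (M + 1)] to [M]. *)
pose x : int := - M.+1%:Z; pose n := (M.+1).*2.
exists x, n, N, C.
have h1 k :
    @comp (Cb B) _ _ _ (proj_map (x + k%:Z)) (inj_map (x + k%:Z)) = idm _.
  apply: chain_mapP => j /=; rewrite -compmA (compmA (b _ _)).
  have [jk|/(is_zero_two_term (N _)) z] :=
    boolP ((j == x + k%:Z) || (j == x + k%:Z + 1)).
    by rewrite ba // comp1m two_term_in_out.
  by apply: zero_hom_eq; left.
have h2 (k l : 'I_n) : k != l ->
    @comp (Cb B) _ _ _ (proj_map (x + k%:Z)) (inj_map (x + l%:Z)) = 0.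
  move=> kl; apply: chain_mapP => j /=; rewrite -compmA (compmA (b _ _)).
  rewrite ba_neq ?comp0m ?compm0 //.
  by apply: contraNneq kl => /addrI[/val_inj ->].
have h3 : \sum_(k < n) @comp (Cb B) _ _ _ (inj_map (x + k%:Z))
    (proj_map (x + k%:Z)) = idm (C : Cb B).
  apply: chain_mapP => j; rewrite cmap_sum /=.
  under eq_bigr do rewrite -compmA out_in_b.
  have [/mP C0|jm] := ltP m `|j|; first by apply: zero_hom_eq; left.
  have k0n : (absz (j + M%:Z)%R < n)%N by lia.
  have k1n : (absz (j + M%:Z + 1)%R < n)%N by lia.
  have -> : j = j - 1 + 1 by rewrite subrK.
  by apply: (ab_sum (k0 := Ordinal k0n) (k1 := Ordinal k1n));
    rewrite /= /x; lia.
exists (@DirectSum (Cb B) _ _ _ (fun k : 'I_n => inj_map (x + k%:Z))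
  (fun k : 'I_n => proj_map (x + k%:Z)) (fun k : 'I_n => h1 k) h2 h3).
exact: isomorphic_refl.
Qed.

End ContractibleSplits.

Lemma contractible_splits (B : addCat) (C : complex B) :
  weakly_idempotent_complete B -> contractible C -> splits C.
Proof.
move=> wic /contractibleP[h hP].
have dat i : {N : B & {u : hom N (C i) & {v : hom (C i) N | splits_at h u v}}}.
  have /cid[N /cid[u /cid[v uv]]] := splits_at_all hP wic i.
  by exists N, u, v.
exact: (splits_of_splits_at hP (fun i => svalP (projT2 (projT2 (dat i))))).
Qed.

(** * Characterizations of weak idempotent completeness *)

Lemma weakly_idempotent_complete_embedding (B B' : addCat) (F : functor B B') :
    full_embedding F -> weakly_idempotent_complete B' ->
    (forall Z, wKar_in (ob_image F) Z -> ob_image F Z) ->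
  weakly_idempotent_complete B.
Proof.
move=> [_ Ffull Ffaith] wic cl.
apply: (weakly_idempotent_complete_wKar_in Ffull Ffaith wic) => Z /cl[X <-].
by exists X; apply: isomorphic_refl.
Qed.

Lemma weakly_idempotent_complete_equivalent (A K : preAddCat) :
  equivalent A K -> weakly_idempotent_complete K ->
  weakly_idempotent_complete A.
Proof.
move=> [F /is_equivalenceP[Ffull Ffaith Fsurj]] wic.
by apply: (weakly_idempotent_complete_wKar_in Ffull Ffaith wic) => Z _.
Qed.

Lemma full_embedding_id (A : preAddCat) : full_embedding (functor_id A).
Proof. by split=> [X Y|X Y g|X Y f g] //; exists g. Qed.

Theorem proposition2p2 (B : addCat) :
  [<->
    (* 1 *)
    weakly_idempotent_complete B;
    (* 2 *)
    forall (B' : addCat) (F : functor B B'),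
      strictly_full_embedding F -> weakly_retraction_closed (ob_image F);
    (* 3 *)
    exists (B' : addCat) (F : functor B B'),
      [/\ full_embedding F, weakly_idempotent_complete B' &
          weakly_retraction_closed (ob_image F)];
    (* 4 *)
    is_equivalence (wkar_emb B);
    (* 5 *)
    exists B'' : addCat, equivalent B (wKar B'');
    (* 6 *)
    exists (B'' B' : addCat) (G : functor B'' B) (F : functor B B'),
      [/\ full_embedding G, full_embedding F, idempotent_complete B' &
          forall Z : B', wKar_in (ob_image (functor_comp F G)) Z <-> ob_image F Z];
    (* 7 *)
    forall C : complex B, contractible C -> splits C].
Proof.
have [strict_full _] := strict_embP B.
have strict_ic := @strict_Kar_idempotent_complete B.
tfae.
- by move=> wic B' F Fstrict; apply: weakly_retraction_closed_image.
- move=> closed; exists (strict_Kar B), (strict_emb B); split=> //.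
    exact: idempotent_complete_weakly.
  exact/closed/strict_embP.
- move=> [B' [F [Femb wic closed]]]; apply: wkar_emb_equivalence.
  apply: (weakly_idempotent_complete_embedding Femb wic) => Z.
  by move=> /closed.
- by move=> eqv; exists B, (wkar_emb B).
- move=> [B'' eqv]; have wic : weakly_idempotent_complete B.
    apply: weakly_idempotent_complete_equivalent eqv _.
    exact: wKar_weakly_idempotent_complete.
  exists B, (strict_Kar B), (functor_id B), (strict_emb B); split=> //.
    exact: full_embedding_id.
  exact: (weakly_retraction_closed_image (strict_embP B) wic).
- move=> [B'' [B' [G [F [Gemb Femb ic FG]]]]] C; apply: contractible_splits.
  apply: (weakly_idempotent_complete_embedding Femb) => [|Z hZ].
    exact: idempotent_complete_weakly.
  apply/FG; apply: wKar_in_idem => [_ _ [X <-] [Y <-]|].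
    exact/ob_image_biproduct/has_biproduct.
  by apply: sub_wKar_in hZ => U /FG.
move=> contr; apply/weakly_idempotent_completeP => X Y i p pi.
exact: splits_retract (contr _ (retract_contractible pi)).
Qed.
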